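(* Let $(\mathfrak{g},\mathfrak{h},\phi)$ and $(\mathfrak{g}',\mathfrak{h}',\phi')$ be morphism Lie algebras, let $(\alpha,\beta)$ be a homomorphism from $(\mathfrak{g},\mathfrak{h},\phi)$ to $(\mathfrak{g}',\mathfrak{h}',\phi')$, and let $(\alpha_t,\beta_t)$, with $\alpha_t=\sum_{i\ge0}\alpha_it^i$ and $\beta_t=\sum_{i\ge0}\beta_it^i$, be a deformation of $(\alpha,\beta)$. Then the infinitesimal $(\alpha_1,\beta_1,0)\in C^1_{\mathsf{mLA}}(\phi,\phi')$ is a $1$-cocycle in $Z^1_{\mathsf{mLA}}(\phi,\phi')$. Moreover, the corresponding cohomology class in $H^1_{\mathsf{mLA}}(\phi,\phi')$ depends only on the equivalence class of the deformation $(\alpha_t,\beta_t)$.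
   Context: All vector spaces and linear maps are over a field $\mathbf{k}$ of characteristic $0$. A morphism Lie algebra is a triple $(\mathfrak{g},\mathfrak{h},\phi)$ of two Lie algebras and a Lie algebra homomorphism $\phi:\mathfrak{g}\to\mathfrak{h}$. A homomorphism $(\mathfrak{g},\mathfrak{h},\phi)\to(\mathfrak{g}',\mathfrak{h}',\phi')$ is a pair $(\alpha,\beta)$ of Lie algebra homomorphisms $\alpha:\mathfrak{g}\to\mathfrak{g}'$, $\beta:\mathfrak{h}\to\mathfrak{h}'$ with $\phi'\circ\alpha=\beta\circ\phi$. Cohomology. For a representation $(V,\rho)$ of a Lie algebra $\mathfrak{g}$, $\delta_{\mathsf{CE}}$ denotes the Chevalley–Eilenberg differential on $\mathrm{Hom}(\wedge^n\mathfrak{g},V)$: $$(\delta_{\mathsf{CE}}f)(x_1,\ldots,x_{n+1})=\sum_{i}(-1)^{i+1}\rho(x_i)f(\ldots,\widehat{x_i},\ldots)+\sum_{i<j}(-1)^{i+j}f([x_i,x_j],\ldots,\widehat{x_i},\ldots,\widehat{x_j},\ldots).$$ Given $(\alpha,\beta)$, regard $\mathfrak{g}'$ as a representation of $\mathfrak{g}$ via $x\mapsto[\alpha(x),-]_{\mathfrak{g}'}$, $\mathfrak{h}'$ as a representation of $\mathfrak{h}$ via $h\mapsto[\beta(h),-]_{\mathfrak{h}'}$, and $\mathfrak{h}'$ as a representation of $\mathfrak{g}$ via $x\mapsto[\beta(\phi(x)),-]_{\mathfrak{h}'}$; let $\delta'_{\mathsf{CE}},\delta''_{\mathsf{CE}},\delta'''_{\mathsf{CE}}$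 be the respective Chevalley–Eilenberg differentials. The complex $C^*_{\mathsf{mLA}}(\phi,\phi')$ is $C^0_{\mathsf{mLA}}(\phi,\phi')=\mathfrak{g}'$, $C^n_{\mathsf{mLA}}(\phi,\phi')=\mathrm{Hom}(\wedge^n\mathfrak{g},\mathfrak{g}')\oplus\mathrm{Hom}(\wedge^n\mathfrak{h},\mathfrak{h}')\oplus\mathrm{Hom}(\wedge^{n-1}\mathfrak{g},\mathfrak{h}')$ for $n\ge1$, with $\delta_{\mathsf{mLA}}(x')=(\delta'_{\mathsf{CE}}(x'),\delta''_{\mathsf{CE}}(\phi'(x')),0)$ for $x'\in\mathfrak{g}'$ and $\delta_{\mathsf{mLA}}(\theta,\gamma,\eta)=(\delta'_{\mathsf{CE}}\theta,\delta''_{\mathsf{CE}}\gamma,\phi'\circ\theta-\gamma\circ\wedge^n\phi-\delta'''_{\mathsf{CE}}\eta)$ for $n\ge1$. $Z^n_{\mathsf{mLA}}$ and $H^n_{\mathsf{mLA}}$ denote its cocycles and cohomology. Deformations. A deformation of $(\alpha,\beta)$ is a pair of formal power series $\alpha_t=\sum_{i\ge0}\alpha_it^i$, $\beta_t=\sum_{i\ge0}\beta_it^i$ with $\alpha_i\in\mathrm{Hom}(\mathfrak{g},\mathfrak{g}')$, $\beta_i\in\mathrm{Hom}(\mathfrak{h},\mathfrak{h}')$, $\alpha_0=\alpha$, $\beta_0=\beta$, such that $\alpha_t([x,y]_{\mathfrak{g}})=[\alpha_t(x),\alpha_t(y)]_{\mathfrak{g}'}$, $\beta_t([h,k]_{\mathfrak{h}})=[\beta_t(h),\beta_t(k)]_{\mathfrak{h}'}$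 for $x,y\in\mathfrak{g}$, $h,k\in\mathfrak{h}$, and $\phi'\circ\alpha_t=\beta_t\circ\phi$. Its infinitesimal is $(\alpha_1,\beta_1,0)$. Let $G',H'$ be the unique simply connected Lie groups integrating $\mathfrak{g}',\mathfrak{h}'$ and $\Phi':G'\to H'$ the Lie group homomorphism integrating $\phi'$. Two deformations $(\alpha_t,\beta_t)$ and $(\alpha'_t,\beta'_t)$ are equivalent if there exists a smooth curve $g'_t$ in $G'$ with $g'_0=1_{G'}$ such that $\alpha'_t(x)=\mathrm{Ad}^{G'}_{g'_t}\circ\alpha_t(x)$ and $\beta'_t(h)=\mathrm{Ad}^{H'}_{\Phi'(g'_t)}\circ\beta_t(h)$ for all $x\in\mathfrak{g}$, $h\in\mathfrak{h}$. *)

(* Defs.v *)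
From HB Require Import structures.
From mathcomp Require Import all_boot all_order all_algebra.
From mathcomp Require Import all_classical all_reals all_analysis.

Set Implicit Arguments.
Unset Strict Implicit.
Unset Printing Implicit Defensive.

Import Order.TTheory GRing.Theory Num.Theory.
Import numFieldNormedType.Exports.

Local Open Scope classical_set_scope.
Local Open Scope ring_scope.

HB.mixin Record Lmodule_isLieAlgebra (K : fieldType) V of GRing.Lmodule K V := {
  lie : V -> V -> V;
  lie_linearl : forall (a : K) (x y z : V),
    lie (a *: x + y) z = a *: lie x z + lie y z;
  lie_linearr : forall (a : K) (x y z : V),
    lie z (a *: x + y) = a *: lie z x + lie z y;
  lie_xx : forall x : V, lie x x = 0;
  lie_jacobi : forall x y z : V,
    lie x (lie y z) + lie y (lie z x) + lie z (lie x y) = 0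
}.

#[short(type="lieAlgType")]
HB.structure Definition LieAlgebra (K : fieldType) :=
  {V of GRing.Lmodule K V & Lmodule_isLieAlgebra K V}.

Definition lie_morph (K : fieldType) (g h : lieAlgType K) (f : g -> h) : Prop :=
  forall x y : g, f (lie x y) = lie (f x) (f y).

Record morphismLie (K : fieldType) := MorphismLie {
  mdom : lieAlgType K;
  mcod : lieAlgType K;
  mmap :> {linear mdom -> mcod};
  mmap_lie : lie_morph mmap
}.

Record morphismLie_hom (K : fieldType) (phi phi' : morphismLie K) :=
  MorphismLieHom {
  hdom : {linear mdom phi -> mdom phi'};
  hcod : {linear mcod phi -> mcod phi'};
  hdom_lie : lie_morph hdom;
  hcod_lie : lie_morph hcod;
  hom_square : forall x : mdom phi, phi' (hdom x) = hcod (phi x)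
}.

(** [Hom(/\^n g, V)] is the set of functions ['I_n -> g] -> V satisfying
    [alternating]; the differentials below are given by their formulas on all
    functions. *)
Definition alternating (K : fieldType) (g V : lmodType K) (n : nat)
    (f : ('I_n -> g) -> V) : Prop :=
  (forall (x : 'I_n -> g) (i : 'I_n) (a : K) (u v : g),
     let upd w := fun j => if j == i then w else x j in
     f (upd (a *: u + v)) = a *: f (upd u) + f (upd v)) /\
  (forall (x : 'I_n -> g) (i j : 'I_n), i != j -> x i = x j -> f x = 0).

Section ChevalleyEilenberg.
Variables (K : fieldType) (g : lieAlgType K) (V : lmodType K).
Variable rho : g -> V -> V.

Definition omit n (i : 'I_n.+1) (x : 'I_n.+1 -> g) : 'I_n -> g :=
  fun k => x (lift i k).

(** The tuple [[x_i, x_j], x_0, .., x_n] with [x_i] and [x_j] omitted, for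
    [i < j]: [bump j \o bump i] enumerates the naturals other than [i], [j]. *)
Definition contract_args n (i j : 'I_n.+1) (x : 'I_n.+1 -> g) : 'I_n -> g :=
  fun k => if k == 0%N :> nat then lie (x i) (x j)
           else x (inord (bump j (bump i k.-1))).

(** Indices start at 0, which changes neither of the two signs. *)
Definition CE n (f : ('I_n -> g) -> V) : ('I_n.+1 -> g) -> V := fun x =>
  \sum_(i < n.+1) (-1) ^+ i *: rho (x i) (f (omit i x))
  + \sum_(i < n.+1) \sum_(j < n.+1 | (i < j)%N)
      (-1) ^+ (i + j) *: f (contract_args i j x).

End ChevalleyEilenberg.

Section MorphismLieComplex.
Variables (K : fieldType) (phi phi' : morphismLie K).
Variable ab : morphismLie_hom phi phi'.

Local Notation g := (mdom phi).
Local Notation h := (mcod phi).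
Local Notation g' := (mdom phi').
Local Notation h' := (mcod phi').

Definition CE1 n := @CE K g g' (fun x => lie (hdom ab x)) n.
Definition CE2 n := @CE K h h' (fun k => lie (hcod ab k)) n.
Definition CE3 n := @CE K g h' (fun x => lie (hcod ab (phi x))) n.

Definition precochain (n : nat) : lmodType K :=
  if n isn't m.+1 then g'
  else (((('I_m.+1 -> g) -> g') * (('I_m.+1 -> h) -> h')
         * (('I_m -> g) -> h'))%type : lmodType K).

Definition CmLA (n : nat) : set (precochain n) :=
  match n return set (precochain n) with
  | 0 => setT
  | m.+1 => [set c | [/\ alternating c.1.1, alternating c.1.2
                       & alternating c.2]]
  end.

Definition dmLA (n : nat) : precochain n -> precochain n.+1 :=
  match n return precochain n -> precochain n.+1 with
  | 0 => fun x' => (CE1 (fun _ : 'I_0 -> g => x'),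
                    CE2 (fun _ : 'I_0 -> h => phi' x'),
                    fun=> 0)
  | m.+1 => fun c => (CE1 c.1.1, CE2 c.1.2,
      fun x => phi' (c.1.1 x) - c.1.2 (phi \o x) - CE3 c.2 x)
  end.

Definition ZmLA (n : nat) : set (precochain n) :=
  [set c | CmLA c /\ dmLA c = 0].

Definition BmLA (n : nat) : set (precochain n) :=
  match n return set (precochain n) with
  | 0 => [set 0]
  | m.+1 => @dmLA m @` @CmLA m
  end.

(** Elements of [H^n] are represented as cosets of [BmLA n] in [ZmLA n]. *)
Definition mLA_class (n : nat) (c : precochain n) : set (precochain n) :=
  [set c' | ZmLA c' /\ BmLA (c' - c)].

(** A power series in [t] with coefficients in [V] is a sequence [nat -> V];
    the product of two power series induced by a biadditive [op]. *)
Definition ps_mul (U V W : nmodType) (op : U -> V -> W)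
    (u : nat -> U) (v : nat -> V) : nat -> W :=
  fun n => \sum_(i < n.+1) op (u i) (v (n - i)%N).

Record deformation := Deformation {
  dalpha : nat -> {linear g -> g'};
  dbeta : nat -> {linear h -> h'};
  dalpha0 : dalpha 0 =1 hdom ab;
  dbeta0 : dbeta 0 =1 hcod ab;
  dalpha_lie : forall x y : g,
    dalpha^~ (lie x y) =1 ps_mul lie (dalpha^~ x) (dalpha^~ y);
  dbeta_lie : forall x y : h,
    dbeta^~ (lie x y) =1 ps_mul lie (dbeta^~ x) (dbeta^~ y);
  dsquare : forall (n : nat) (x : g), phi' (dalpha n x) = dbeta n (phi x)
}.

Definition infinitesimal (D : deformation) : precochain 1 :=
  (fun x : 'I_1 -> g => dalpha D 1 (x ord0),
   fun x : 'I_1 -> h => dbeta D 1 (x ord0),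
   fun=> 0).

End MorphismLieComplex.

(** For [V] of finite dimension and [U] open this is the usual notion. *)
Fixpoint Ck (R : realType) (V W : normedModType R) (k : nat)
    (U : set V) (f : V -> W) : Prop :=
  if k isn't k'.+1 then forall x, U x -> {for x, continuous f}
  else (forall x, U x -> differentiable f x) /\ (forall v, Ck k' U ('D_v f)).

Definition smooth_on (R : realType) (V W : normedModType R)
    (U : set V) (f : V -> W) : Prop := forall k, Ck k U f.

Record chart (R : realType) (n : nat) (M : topologicalType) := Chart {
  cdom : set M;
  ccod : set 'rV[R]_n;
  chart_map :> M -> 'rV[R]_n;
  cinv : 'rV[R]_n -> M;
  cdom_open : open cdom;
  ccod_open : open ccod;
  chart_map_cod : forall x, cdom x -> ccod (chart_map x);
  cinv_dom : forall v, ccod v -> cdom (cinv v);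
  chart_mapK : forall x, cdom x -> cinv (chart_map x) = x;
  cinvK : forall v, ccod v -> chart_map (cinv v) = v;
  chart_map_cont : forall x, cdom x -> {for x, continuous chart_map};
  cinv_cont : forall v, ccod v -> {for v, continuous cinv}
}.

Definition smooth_atlas (R : realType) (n : nat) (M : topologicalType)
    (A : set (chart R n M)) : Prop :=
  (forall x : M, exists2 c, A c & cdom c x) /\
  (forall c d, A c -> A d ->
     smooth_on [set v | ccod c v /\ cdom d (cinv c v)]
               (fun v => d (cinv c v))).

#[short(type="topGroupType")]
HB.structure Definition TopGroup := {G of Group G & Topological G}.

Record lieGroup (R : realType) := LieGroup {
  lgrp :> topGroupType;
  ldim : nat;
  atlas : set (chart R ldim lgrp);
  atlasP : smooth_atlas atlas;
  lgrp_hausdorff : hausdorff_space lgrp;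
  lgrp_second_countable : @second_countable lgrp;
  lmul_cont : continuous (fun p : lgrp * lgrp => (p.1 * p.2)%g);
  lmul_smooth : forall a b c, atlas a -> atlas b -> atlas c ->
    smooth_on [set p : 'rV[R]_ldim * 'rV[R]_ldim | [/\ ccod a p.1, ccod b p.2
                  & cdom c (cinv a p.1 * cinv b p.2)%g]]
              (fun p => c (cinv a p.1 * cinv b p.2)%g);
  linv_cont : continuous (fun x : lgrp => x^-1%g);
  linv_smooth : forall a b, atlas a -> atlas b ->
    smooth_on [set v | ccod a v /\ cdom b (cinv a v)^-1%g]
              (fun v => b (cinv a v)^-1%g)
}.

Definition lie_group_morph (R : realType) (G H : lieGroup R) (F : G -> H) :=
  [/\ forall x y : G, F (x * y)%g = (F x * F y)%g,
      continuous F
    & forall a b, atlas a -> atlas b ->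
        smooth_on [set v | ccod a v /\ cdom b (F (cinv a v))]
                  (fun v => b (F (cinv a v)))].

Definition smooth_curve_at0 (R : realType) (G : lieGroup R) (gam : R -> G) :=
  exists2 e : R, 0 < e &
    (forall t : R, `|t| < e -> {for t, continuous gam}) /\
    (forall c, atlas c ->
       smooth_on [set t : R^o | `|t| < e /\ cdom c (gam t)]
                 (fun t : R^o => c (gam t))).

Definition simply_connected (R : realType) (T : topologicalType) : Prop :=
  (forall x y : T, exists p : R -> T,
     [/\ {within `[0, 1], continuous p}, p 0 = x & p 1 = y]) /\
  (forall p : R -> T, {within `[0, 1], continuous p} -> p 0 = p 1 ->
     exists H : R * R -> T,
       [/\ {within `[0, 1] `*` `[0, 1], continuous H},
           forall s, s \in `[0, 1] -> H (s, 0) = p s /\ H (s, 1) = p 0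
         & forall t, t \in `[0, 1] -> H (0, t) = p 0 /\ H (1, t) = p 0]).

(** Tangent space at 1, read in a chart [c] around 1. *)
Section TangentLieAlgebra.
Variables (R : realType) (G : lieGroup R) (c : chart R (ldim G) G).
Local Notation E := 'rV[R]_(ldim G).

(** The left-invariant vector field with value [v] at 1, in the chart [c]. *)
Definition left_field (v : E) : E -> E := fun x =>
  'd (fun y : E => c (cinv c x * cinv c y)%g) (c 1%g) v.

Definition vf_commutator (X Y : E -> E) : E -> E := fun x =>
  'D_(X x) Y x - 'D_(Y x) X x.

Definition tangent_lie (u v : E) : E :=
  vf_commutator (left_field u) (left_field v) (c 1%g).

Definition Ad (x : G) (v : E) : E :=
  'd (fun y : E => c (x * cinv c y * x^-1)%g) (c 1%g) v.

End TangentLieAlgebra.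

(** An identification of [g] with the Lie algebra of [G]. The base field [K] is
    an extension of the reals through [iota], which must be the reals or the
    complex numbers when [g] is non-zero; for complex [g], the Lie group
    integrating [g] is considered as a real Lie group. *)
Record integration (R : realType) (K : fieldType) (iota : {rmorphism R -> K})
    (G : lieGroup R) (g : lieAlgType K) := Integration {
  ichart : chart R (ldim G) G;
  ichart_atlas : atlas ichart;
  ichart1 : cdom ichart 1%g;
  iso : 'rV[R]_(ldim G) -> g;
  iso_inv : g -> 'rV[R]_(ldim G);
  isoK : cancel iso iso_inv;
  iso_invK : cancel iso_inv iso;
  iso_linear : forall (r : R) u v,
    iso (r *: u + v) = iota r *: iso u + iso v;
  iso_lie : forall u v, iso (tangent_lie ichart u v) = lie (iso u) (iso v)
}.

Section Integration.
Variables (R : realType) (K : fieldType) (iota : {rmorphism R -> K}).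

Definition integrates_morph (G H : lieGroup R) (g h : lieAlgType K)
    (IG : integration iota G g) (IH : integration iota H h)
    (F : G -> H) (f : g -> h) : Prop :=
  lie_group_morph F /\
  forall u, iso IH ('d (fun y => ichart IH (F (cinv (ichart IG) y)))
                       (ichart IG 1%g) u) = f (iso IG u).

(** The coefficients of the Taylor series at 0 of [t |-> Ad_(gam t)], as maps
    on [g]. *)
Definition Ad_taylor (G : lieGroup R) (g : lieAlgType K)
    (IG : integration iota G g) (gam : R -> G) (n : nat) (x : g) : g :=
  iso IG ((n`!%:R)^-1 *:
    derive1n n (fun t : R => Ad (ichart IG) (gam t) (iso_inv IG x)) 0).

Definition equivalent_deformations (phi phi' : morphismLie K)
    (ab : morphismLie_hom phi phi') (G H : lieGroup R)
    (IG : integration iota G (mdom phi')) (IH : integration iota H (mcod phi'))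
    (Phi : G -> H) (D D' : deformation ab) : Prop :=
  exists gam : R -> G,
    [/\ smooth_curve_at0 gam, gam 0 = 1%g,
        forall x, dalpha D' ^~ x =1
          ps_mul (fun (A : mdom phi' -> mdom phi') y => A y)
                 (Ad_taylor IG gam) (dalpha D ^~ x)
      & forall x, dbeta D' ^~ x =1
          ps_mul (fun (A : mcod phi' -> mcod phi') y => A y)
                 (Ad_taylor IH (Phi \o gam)) (dbeta D ^~ x)].

End Integration.

(* Main.v *)
(** The degree-1 coefficient of the bracket and square conditions on a
    deformation is the cocycle equation. For an equivalence given by a curve
    [g_t] with velocity [xi] at 0, the degree-1 coefficient of
    [alpha'_t = Ad_(g_t) alpha_t] reads [alpha'_1 = alpha_1 + [xi, alpha]], and
    similarly for [beta] with [phi' xi], the velocity of [Phi (g_t)]; hence the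
    infinitesimals differ by the coboundary of [- xi].

    The analytic input is that [Ad_(g_t) v] has derivative [[xi, v]] at [t = 0],
    the bracket being that of left-invariant vector fields. Let [m(x, y)] be the
    product read in a chart, with unit [e]. Then [left_field v x] is
    [D_(0,v) m (x, e)], so the bracket of [u] and [v] is
    [D_(u,0) D_(0,v) m - D_(v,0) D_(0,u) m] at [(e, e)]. On the other hand
    [Ad_(g_t) v] is [D_(w_t,0) m (g_t, g_t^-1)] where
    [w_t := D_(0,v) m (g_t, e)]. Differentiating gives
    [D_(u,0) D_(0,v) m + D_(u,-u) D_(v,0) m], and the last term is
    [- D_(v,0) D_(0,u) m] by symmetry of second derivatives because
    [D_(u,0) m (x, e) = u] is constant in [x]. *)

Require Import Defs.
From HB Require Import structures.
From mathcomp Require Import all_boot all_order all_algebra.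
From mathcomp Require Import all_classical all_reals all_analysis.
From mathcomp Require Import ring lra.

Set Implicit Arguments.
Unset Strict Implicit.
Unset Printing Implicit Defensive.

Import Order.TTheory GRing.Theory Num.Theory.
Import numFieldNormedType.Exports.

Local Open Scope ring_scope.
Local Open Scope classical_set_scope.

(** * Symmetry of second derivatives *)

Lemma is_derive_comp (R : realType) (U V W : normedModType R) (g : U -> V)
    (f : V -> W) (x v : U) (dg : V) :
  differentiable g x -> 'D_v g x = dg -> differentiable f (g x) ->
  is_derive x v (f \o g) ('D_dg f (g x)).
Proof.
move=> gx <- fx; have fgx := differentiable_comp gx fx.
apply: DeriveDef; first exact: diff_derivable.
by rewrite !deriveE// diff_comp.
Qed.

Lemma is_derive_line (R : realType) (V W : normedModType R) (f : V -> W)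
    (a u : V) (s : R) :
  differentiable f (a + s *: u) ->
  is_derive s 1 (fun s => f (a + s *: u)) ('D_u f (a + s *: u)).
Proof.
move=> fd; have ls : is_diff s (fun s : R => a + s *: u) (0 + *:%R^~ u).
  exact: is_diffD.
apply: (@is_derive_comp _ _ _ _ (fun s : R => a + s *: u)) => //.
by rewrite deriveE// diff_val fctE add0r scale1r.
Qed.

Lemma differentiable_le (R : realType) (V W : normedModType R) (f : V -> W)
    (p : V) (e : R) :
  differentiable f p -> 0 < e ->
  \forall x \near 0, `|f (p + x) - f p - 'D_x f p| <= e * `|x|.
Proof.
move=> fp e0; have := diff_locallyxC fp.
set k := 'o _ => fE.
have := littleoP [littleo of k] e0; apply: filterS => x.
suff -> : f (p + x) - f p - 'D_x f p = k x by apply.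
by rewrite fE deriveE// -addrA -opprD addrAC subrr add0r.
Qed.

(** The mean value theorem along [u], applied to [k x], the increment of [f] by [s *: v] from
    [p + x *: u], turns the second difference into [s] times an increment of ['D_u f]. In the
    first-order expansion of ['D_u f] at [p] the contributions of [x *: u] cancel, which leaves
    [s ^+ 2 * 'D_v ('D_u f) p]. *)
Lemma second_difference (R : realType) (V : normedModType R) (f : V -> R)
    (p u v : V) (e : R) :
  (\forall x \near p, differentiable f x) -> differentiable ('D_u f) p ->
  0 < e ->
  \forall s \near 0^'+,
    `|f (p + s *: v + s *: u) - f (p + s *: u) - f (p + s *: v) + f p
      - s ^+ 2 * 'D_v ('D_u f) p| <= e * s ^+ 2.
Proof.
move=> fp Gp e0; set G := 'D_u f.
(* For [0 <= x <= s] the displacements [x *: u] and [s *: v + x *: u] have total norm at most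
   [s * N]; the summand 1 keeps [N] positive when [u] and [v] vanish. *)
pose N := 2 * (`|u| + `|v|) + 1.
have N0 : 0 < N by rewrite ltr_wpDl// mulr_ge0// addr_ge0.
have eN0 : 0 < e / N by rewrite divr_gt0.
have /nbhs_normP[d1 /= d10 Gd] := differentiable_le Gp eN0.
move/nbhs0P : fp => /nbhs_normP[d2 /= d20 fd].
have small s x : 0 <= x <= s -> 0 < s ->
    `|x *: u| + `|s *: v + x *: u| <= s * N.
  move=> /andP[x0 xs] s0.
  have A : `|x *: u| <= s * `|u|.
    by rewrite normrZ ger0_norm// ler_wpM2r.
  have B : `|s *: v| = s * `|v| by rewrite normrZ gtr0_norm.
  have su : 0 <= s * `|u| by rewrite mulr_ge0// ltW.
  have sv : 0 <= s * `|v| by rewrite mulr_ge0// ltW.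
  have C := ler_normD (s *: v) (x *: u).
  have sN : s * N = 2 * (s * `|u|) + 2 * (s * `|v|) + s by rewrite /N; ring.
  lra.
have near_d (a b c d : R) : 0 <= a -> 0 <= b -> a + b <= c -> c < d ->
    a < d /\ b < d by move=> *; split; lra.
(* Here [a], [b], [g] stand for the values of ['D_u f] at the two displaced points and at [p], and
   [l], [l'] for its derivatives at [p] along [v] and [x *: u]; both [g] and [l'] cancel in
   [a - b]. *)
have estimate (s a b g l l' q A B : R) : 0 < s -> q = (a - b) * s ->
    `|b - g - l'| <= e / N * A -> `|a - g - (s * l + l')| <= e / N * B ->
    A + B <= s * N -> `|q - s ^+ 2 * l| <= e * s ^+ 2.
  move=> s0 -> bA aB AB.
  have -> : (a - b) * s - s ^+ 2 * l =
    s * ((a - g - (s * l + l')) - (b - g - l')) by ring.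
  have -> : e * s ^+ 2 = s * (e / N * (s * N)) by field; rewrite gt_eqF.
  rewrite normrM gtr0_norm// ler_wpM2l// ?(ltW s0)//.
  rewrite (le_trans (ler_normB _ _))//.
  by rewrite (le_trans (lerD aB bA))// -mulrDr addrC ler_wpM2l// ltW.
near=> s.
have s0 : 0 < s by near: s; exact: nbhs_right_gt.
have sd1 : s * N < d1.
  by rewrite -ltr_pdivlMr//; near: s; apply: nbhs_right_lt; exact: divr_gt0.
have sd2 : s * N < d2.
  by rewrite -ltr_pdivlMr//; near: s; apply: nbhs_right_lt; exact: divr_gt0.
pose k x := f (p + s *: v + x *: u) - f (p + x *: u).
have kd x : 0 <= x <= s ->
    is_derive x 1 k (G (p + s *: v + x *: u) - G (p + x *: u)).
  move=> xs; have ss := small s x xs s0.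
  have [ux uvx] := near_d _ _ _ _ (normr_ge0 _) (normr_ge0 _) ss sd2.
  apply: is_deriveB; apply: is_derive_line.
    by rewrite -addrA; apply: fd; rewrite /= sub0r normrN.
  by apply: fd; rewrite /= sub0r normrN.
have [x||x] :=
  @MVT R k (fun x => G (p + s *: v + x *: u) - G (p + x *: u)) 0 s s0.
- by rewrite in_itv/= => /andP[/ltW x0 /ltW xs]; apply: kd; rewrite x0 xs.
- apply: derivable_within_continuous => z; rewrite in_itv/= => zs.
  by have [] := kd z zs.
rewrite in_itv/= => /andP[/ltW x0 /ltW xs].
have {}xs : 0 <= x <= s by rewrite x0 xs.
have ss := small s x xs s0.
have [ux uvx] := near_d _ _ _ _ (normr_ge0 _) (normr_ge0 _) ss sd1.
rewrite subr0 /k !scale0r !addr0 => kE.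
have {}Gd y : `|y| < d1 -> `|G (p + y) - G p - 'D_y G p| <= e / N * `|y|.
  by move=> yd; apply: Gd; rewrite /= sub0r normrN.
have Gu := Gd _ ux; have := Gd _ uvx.
have -> : 'D_(s *: v + x *: u) G p = s * 'D_v G p + 'D_(x *: u) G p.
  by rewrite !deriveE// linearD linearZ.
rewrite addrA => Gv.
have -> : f (p + s *: v + s *: u) - f (p + s *: u) - f (p + s *: v) + f p =
  f (p + s *: v + s *: u) - f (p + s *: u) - (f (p + s *: v) - f p) by ring.
exact: estimate s0 kE Gu Gv ss.
Unshelve. all: by end_near. Qed.

(* Young's form of the symmetry of second derivatives: both orders are the
   limit of the same second difference. *)
Lemma derive_commute_real (R : realType) (V : normedModType R) (f : V -> R)
    (p u v : V) :
  (\forall x \near p, differentiable f x) -> differentiable ('D_u f) p ->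
  differentiable ('D_v f) p -> 'D_v ('D_u f) p = 'D_u ('D_v f) p.
Proof.
move=> fp up vp; apply/eqP; rewrite -subr_eq0 -normr_le0.
apply/ler_addgt0Pr => e e0; rewrite add0r.
have e2 : 0 < e / 2 by rewrite divr_gt0.
have A := second_difference v fp up e2; have B := second_difference u fp vp e2.
have [s [[{}A {}B] s0]] := filter_ex (filterI (filterI A B) (nbhs_right_gt 0)).
have estimate (q l l' r : R) : 0 < r -> `|q - r * l| <= e / 2 * r ->
    `|q - r * l'| <= e / 2 * r -> `|l - l'| <= e.
  move=> r0 ql ql'; rewrite -(ler_pM2l r0) -{1}(gtr0_norm r0) -normrM.
  have -> : r * (l - l') = (q - r * l') - (q - r * l) by ring.
  rewrite (le_trans (ler_normB _ _))// (le_trans (lerD ql' ql))//.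
  by rewrite -mulrDl -splitr mulrC.
apply: estimate A _; first by rewrite exprn_gt0.
by rewrite (addrAC (f _)) (addrAC p).
Qed.

Lemma differentiable_entry (R : realType) (V : normedModType R) m n
    (f : V -> 'M[R]_(m, n)) (p : V) i j :
  differentiable f p -> differentiable (fun x => f x i j) p.
Proof.
move=> fp; apply: (@differentiable_comp _ _ _ _ f (fun M => M i j)) => //.
exact: differentiable_coord.
Qed.

Lemma derive_entry (R : realType) (V : normedModType R) m n
    (f : V -> 'M[R]_(m, n)) (p v : V) i j :
  differentiable f p -> 'D_v f p i j = 'D_v (fun x => f x i j) p.
Proof. by move=> fp; rewrite derive_mx ?mxE//; exact: diff_derivable. Qed.

(** The affine expansion of [f] at [a] also serves [g], and uniqueness of the differential
    identifies its linear part with ['d g a]. *)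
Lemma near_eq_differentiable (R : realType) (V W : normedModType R)
    (f g : V -> W) (a : V) :
  {near a, f =1 g} -> differentiable f a -> differentiable g a.
Proof.
move=> fg fa; have [fc fE] := (diff_locallyP _ _).1 fa.
have gE : g \o shift a = cst (g a) + 'd f a +o_ 0 id.
  apply/eqaddoP => e e0; have := (eqaddoP _ _ _ _).1 fE e e0.
  have fg0 : \forall h \near 0, f (h + a) = g (h + a).
    by move/nbhs0P : fg; apply: filterS => h; rewrite addrC.
  apply: filterS2 fg0 => h /= fgh.
  by rewrite !fctE/= -fgh -(nbhs_singleton fg).
apply/diff_locallyP; suff -> : 'd g a = 'd f a :> (V -> W) by split.
exact: diff_unique.
Qed.

(** Reduction to real-valued entries. Taking an entry commutes with ['D_w] only where [f] is
    differentiable, hence near [p], which is enough to differentiate once more at [p]. *)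
Lemma derive_commute (R : realType) (V : normedModType R) m n
    (f : V -> 'M[R]_(m, n)) (p u v : V) :
  (\forall x \near p, differentiable f x) -> differentiable ('D_u f) p ->
  differentiable ('D_v f) p -> 'D_v ('D_u f) p = 'D_u ('D_v f) p.
Proof.
move=> fp up vp; apply/matrixP => i j.
have E w : {near p, (fun x => 'D_w f x i j) =1 'D_w (fun x => f x i j)}.
  by apply: filterS fp => x fx; exact: derive_entry.
have DE w w' : differentiable ('D_w f) p ->
    'D_w' ('D_w f) p i j = 'D_w' ('D_w (fun x => f x i j)) p.
  by move=> wp; rewrite derive_entry//; apply: near_eq_derive; exact: E.
apply: (etrans (DE u v up)); apply: etrans (esym (DE v u vp)).
apply: derive_commute_real.
- by apply: filterS fp => x; exact: differentiable_entry.
- by apply: near_eq_differentiable (E _) _; exact: differentiable_entry.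
- by apply: near_eq_differentiable (E _) _; exact: differentiable_entry.
Qed.

(** * The group law in a chart *)

Lemma diff_pairr (R : realType) (U V : normedModType R) (x : U) (y : V) :
  is_diff y (fun z => (x, z)) (fun z => (0, z)).
Proof. exact: is_diff_pair. Qed.

Lemma diff_pairl (R : realType) (U V : normedModType R) (x : U) (y : V) :
  is_diff x (fun z => (z, y)) (fun z => (z, 0)).
Proof. exact: is_diff_pair. Qed.

Lemma differentiable_pairr (R : realType) (U V W : normedModType R)
    (f : U * V -> W) (x : U) (y : V) :
  differentiable f (x, y) -> differentiable (fun z => f (x, z)) y.
Proof.
move=> fd; have [pd _] := diff_pairr x y.
exact: (differentiable_comp pd fd).
Qed.

Lemma differentiable_pairl (R : realType) (U V W : normedModType R)
    (f : U * V -> W) (x : U) (y : V) :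
  differentiable f (x, y) -> differentiable (fun z => f (z, y)) x.
Proof.
move=> fd; have [pd _] := diff_pairl x y.
exact: (differentiable_comp pd fd).
Qed.

Lemma is_derive_pairr (R : realType) (U V W : normedModType R) (f : U * V -> W)
    (x : U) (y v : V) :
  differentiable f (x, y) ->
  is_derive y v (fun z => f (x, z)) ('D_(0, v) f (x, y)).
Proof.
move=> fd; have H := diff_pairr x y.
apply: (@is_derive_comp _ _ _ _ (fun z : V => (x, z))) => //.
by rewrite deriveE// diff_val.
Qed.

Lemma is_derive_pairl (R : realType) (U V W : normedModType R) (f : U * V -> W)
    (x v : U) (y : V) :
  differentiable f (x, y) ->
  is_derive x v (fun z => f (z, y)) ('D_(v, 0) f (x, y)).
Proof.
move=> fd; have H := diff_pairl x y.
apply: (@is_derive_comp _ _ _ _ (fun z : U => (z, y))) => //.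
by rewrite deriveE// diff_val.
Qed.

Lemma is_derive_curve (R : realType) (V W : normedModType R) (f : V -> W)
    (gam : R -> V) (t : R) (u : V) :
  is_derive t 1 gam u -> differentiable f (gam t) ->
  is_derive t 1 (f \o gam) ('D_u f (gam t)).
Proof.
by move=> [gt gu] ft; apply: is_derive_comp => //; apply/derivable1_diffP.
Qed.

Lemma is_derive_pair_curve (R : realType) (U V : normedModType R)
    (f : R -> U) (g : R -> V) (t : R) (df : U) (dg : V) :
  is_derive t 1 f df -> is_derive t 1 g dg ->
  is_derive t 1 (fun s => (f s, g s)) (df, dg).
Proof.
move=> [/derivable1_diffP ft fu] [/derivable1_diffP gt gu].
apply: DeriveDef; first by apply/derivable1_diffP; exact: differentiable_pair.
by rewrite deriveE ?diff_pair -?deriveE ?fu ?gu//; exact: differentiable_pair.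
Qed.

Lemma is_derive_entry (R : realType) (V : normedModType R) m n
    (f : V -> 'M[R]_(m, n)) (p v : V) (df : 'M[R]_(m, n)) i j :
  is_derive p v f df -> is_derive p v (fun x => f x i j) (df i j).
Proof.
case=> fp fd; apply: DeriveDef; first exact: ((derivable_mxP f p v).1 fp).
have dfE := etrans (esym fd) (derive_mx fp).
exact: esym (etrans (congr1 (fun A : 'M[R]_(m, n) => A i j) dfE) (mxE _ _ _ _)).
Qed.

(** The Leibniz rule, read off entry by entry from the product rule for real functions. *)
Lemma is_derive_scale (R : realType) m n (k : R -> R) (f : R -> 'M[R]_(m, n))
    (t dk : R) (df : 'M[R]_(m, n)) :
  is_derive t 1 k dk -> is_derive t 1 f df ->
  is_derive t 1 (fun s => k s *: f s) (dk *: f t + k t *: df).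
Proof.
move=> kd fd; have fdE i j := is_derive_entry i j fd.
have M i j := is_deriveM kd (fdE i j).
have E i j : (fun s => (k s *: f s) i j) = k * (fun s => f s i j) :> (R -> R).
  by apply/funext => s; rewrite mxE.
have {}M i j := eq_ind_r (fun g => is_derive t 1 g _) (M i j) (E i j).
have D : derivable (fun s => k s *: f s) t 1.
  by apply/derivable_mxP => i j; have [] := M i j.
apply: DeriveDef => //; rewrite derive_mx//; apply/matrixP => i j.
have [_ Mij] := M i j; rewrite mxE; apply: (etrans Mij).
rewrite addrC; apply/esym; rewrite !mxE.
by congr (_ + _); exact: mulrC.
Qed.

Lemma derive_sum_dir (R : realType) (V W : normedModType R) (f : V -> W)
    (p : V) n (a : 'I_n -> R) (v : 'I_n -> V) :
  differentiable f p ->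
  'D_(\sum_(j < n) a j *: v j) f p = \sum_(j < n) a j *: 'D_(v j) f p.
Proof.
move=> fp; rewrite deriveE// linear_sum; apply: eq_bigr => j _.
by rewrite linearZ/= deriveE.
Qed.

Section LieGroupChart.
Variables (R : realType) (G : lieGroup R) (c : chart R (ldim G) G).
Hypotheses (cA : atlas c) (c1 : cdom c 1%g).
Local Notation E := 'rV[R]_(ldim G).
Local Notation e := (c 1%g).

Definition chart_mul (p : E * E) : E := c (cinv c p.1 * cinv c p.2)%g.
Local Notation m := chart_mul.

(** The set on which [lmul_smooth], taken with the chart [c] in all three places, gives
    smoothness. *)
Definition chart_mul_dom : set (E * E) :=
  [set p | [/\ ccod c p.1, ccod c p.2 & cdom c (cinv c p.1 * cinv c p.2)%g]].
Local Notation W := chart_mul_dom.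

(** Openness follows from continuity of the group multiplication and of [cinv]. *)
Lemma chart_mul_dom_nbhs p : W p -> nbhs p W.
Proof.
move=> [p1 p2 p12].
have f1 : \forall q \near p, ccod c q.1.
  apply: (@cvg_fst _ _ (nbhs p.1) (nbhs p.2)); apply: open_nbhs_nbhs.
  by split => //; exact: ccod_open.
have f2 : \forall q \near p, ccod c q.2.
  apply: (@cvg_snd _ _ (nbhs p.1) (nbhs p.2)); apply: open_nbhs_nbhs.
  by split => //; exact: ccod_open.
have f3 : \forall q \near p, cdom c (cinv c q.1 * cinv c q.2)%g.
  have pc : {for p, continuous (fun q : E * E => (cinv c q.1, cinv c q.2))}.
    apply: cvg_pair.
      apply: (@continuous_comp _ _ _ fst (cinv c)); first exact: cvg_fst.
      exact: cinv_cont.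
    apply: (@continuous_comp _ _ _ snd (cinv c)); first exact: cvg_snd.
    exact: cinv_cont.
  have mc := continuous_comp pc (@lmul_cont R G _).
  by apply: mc; apply: open_nbhs_nbhs; split => //; exact: cdom_open.
by apply: filterS3 f1 f2 f3 => q; split.
Qed.

Lemma chart_mul_diff p : W p -> differentiable m p.
Proof. exact: (lmul_smooth cA cA cA 1).1. Qed.

Lemma chart_mul_diff2 v p : W p -> differentiable ('D_v m) p.
Proof. exact: ((lmul_smooth cA cA cA 2).2 v).1. Qed.

Lemma cinv_e : cinv c e = 1%g. Proof. exact: chart_mapK. Qed.

Lemma ccod_e : ccod c e. Proof. exact: chart_map_cod. Qed.

Lemma chart_mul1l y : ccod c y -> m (e, y) = y.
Proof. by move=> cy; rewrite /m /= cinv_e mul1g cinvK. Qed.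

Lemma chart_mul1r x : ccod c x -> m (x, e) = x.
Proof. by move=> cx; rewrite /m /= cinv_e mulg1 cinvK. Qed.

Lemma chart_mul_dom1l y : ccod c y -> W (e, y).
Proof.
move=> cy; split=> //=; first exact: ccod_e.
by rewrite cinv_e mul1g; exact: cinv_dom.
Qed.

Lemma chart_mul_dom1r x : ccod c x -> W (x, e).
Proof.
move=> cx; split=> //=; first exact: ccod_e.
by rewrite cinv_e mulg1; exact: cinv_dom.
Qed.

Lemma chart_mul_dom_ee : W (e, e).
Proof. by apply: chart_mul_dom1l; exact: ccod_e. Qed.

Lemma ccod_nbhs x : ccod c x -> \forall y \near x, ccod c y.
Proof. by move=> cx; apply: open_nbhs_nbhs; split => //; exact: ccod_open. Qed.

Lemma derive_chart_mul1l y v : ccod c y -> 'D_(0, v) m (e, y) = v.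
Proof.
move=> cy; have := is_derive_pairr v (chart_mul_diff (chart_mul_dom1l cy)).
move=> /@derive_val <-; rewrite -[RHS](@derive_id _ _ y); apply: near_eq_derive.
by apply: filterS (ccod_nbhs cy) => z; exact: chart_mul1l.
Qed.

Lemma derive_chart_mul1r x v : ccod c x -> 'D_(v, 0) m (x, e) = v.
Proof.
move=> cx; have := is_derive_pairl v (chart_mul_diff (chart_mul_dom1r cx)).
move=> /@derive_val <-; rewrite -[RHS](@derive_id _ _ x); apply: near_eq_derive.
by apply: filterS (ccod_nbhs cx) => z; exact: chart_mul1r.
Qed.

Lemma derive_pairE p u v : W p -> 'D_(u, v) m p = 'D_(u, 0) m p + 'D_(0, v) m p.
Proof.
move=> Wp; have mp := chart_mul_diff Wp.
rewrite !deriveE// -linearD; congr ('d _ _ _).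
by congr pair; rewrite ?addr0 ?add0r.
Qed.

Lemma derive_chart_mul_ee u v : 'D_(u, v) m (e, e) = u + v.
Proof.
rewrite derive_pairE; last exact: chart_mul_dom_ee.
by rewrite derive_chart_mul1r ?derive_chart_mul1l//; exact: ccod_e.
Qed.

Lemma left_fieldE v x : ccod c x -> left_field c v x = 'D_(0, v) m (x, e).
Proof.
move=> cx; have mp := chart_mul_diff (chart_mul_dom1r cx).
have /@derive_val <- := is_derive_pairr v mp.
rewrite /left_field -deriveE//; exact: differentiable_pairr mp.
Qed.

Lemma derive_left_field u v :
  'D_u (left_field c v) e = 'D_(u, 0) ('D_(0, v) m) (e, e).
Proof.
have := is_derive_pairl u (chart_mul_diff2 (0, v) chart_mul_dom_ee).
move=> /@derive_val <-; apply: near_eq_derive.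
by apply: filterS (ccod_nbhs ccod_e) => x; exact: left_fieldE.
Qed.

(** At [e] the left-invariant field of [v] has value [v], so the commutator differentiates the two
    fields in the directions [u] and [v] themselves. *)
Lemma tangent_lieE u v : tangent_lie c u v =
  'D_(u, 0) ('D_(0, v) m) (e, e) - 'D_(v, 0) ('D_(0, u) m) (e, e).
Proof.
rewrite /tangent_lie /vf_commutator !left_fieldE; try exact: ccod_e.
by rewrite !derive_chart_mul1l ?derive_left_field//; exact: ccod_e.
Qed.

(** Chain rule: the inner map sends [e] to [m (x, e) = x], so the outer factor is differentiated at
    [(x, y)] in its first argument, along the image of [v] under left translation by [x]. *)
Lemma chart_conj x y v : ccod c x -> W (x, y) ->
  differentiable (fun z => m (m (x, z), y)) e /\
  'D_v (fun z => m (m (x, z), y)) e = 'D_('D_(0, v) m (x, e), 0) m (x, y).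
Proof.
move=> cx Wxy; have mx := chart_mul_diff (chart_mul_dom1r cx).
have mxy := chart_mul_diff Wxy; have mxe := chart_mul1r cx.
have [_ mx1] := is_derive_pairr v mx.
have h1 := differentiable_pairr mx.
have h2 := eq_ind_r (fun z => differentiable (fun t => m (t, y)) z)
  (differentiable_pairl mxy) mxe.
split; first exact: (differentiable_comp h1 h2).
have [_ D] := is_derive_comp h1 mx1 h2; apply: etrans D _.
have [_ D] := is_derive_pairl ('D_(0, v) m (x, e)) mxy.
set w := 'D_(0, v) m (x, e) in D *.
exact: etrans (congr1 (fun z => 'D_w (fun t => m (t, y)) z) mxe) D.
Qed.

Lemma AdE x v : cdom c x -> cdom c x^-1%g ->
  Ad c x v = 'D_('D_(0, v) m (c x, e), 0) m (c x, c x^-1%g).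
Proof.
move=> cx cx'; have ccx := chart_map_cod cx; have Wx := chart_mul_dom1r ccx.
have Wx' : W (c x, c x^-1%g).
  split=> /=; [exact: chart_map_cod|exact: chart_map_cod|].
  by rewrite !chart_mapK// mulgV.
have [gd gv] := chart_conj v ccx Wx'.
(* Conjugation is computed by two products in the chart only if the intermediate product stays in
   [cdom c]; this holds for [y] near [e] by openness of [W]. *)
have gE : {near e, (fun y => m (m (c x, y), c x^-1%g)) =1
                   (fun y => c (x * cinv c y * x^-1)%g)}.
  have H : \forall y \near e, W (c x, y).
    have [/differentiable_continuous pc _] := diff_pairr (c x) e.
    exact: pc (chart_mul_dom_nbhs Wx).
  apply: (filterS _ H) => y [/= _ _]; rewrite (chart_mapK cx) => cxy.
  by rewrite /m /= (chart_mapK cx) (chart_mapK cx') (chart_mapK cxy).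
rewrite /Ad -deriveE; last exact: (near_eq_differentiable gE gd).
exact: etrans (esym (near_eq_derive v gE)) gv.
Qed.

End LieGroupChart.

(** * The derivative of the adjoint representation along a curve *)

Lemma derive_dirB (R : realType) (V W : normedModType R) (f : V -> W)
    (p u v w : V) :
  (\forall x \near p, differentiable f x) -> differentiable ('D_u f) p ->
  differentiable ('D_v f) p ->
  'D_w ('D_(u - v) f) p = 'D_w ('D_u f) p - 'D_w ('D_v f) p.
Proof.
move=> fp up vp; rewrite -deriveB; try exact: diff_derivable.
apply: near_eq_derive; apply: filterS fp => x fx.
change ('D_(u - v) f x = 'D_u f x - 'D_v f x).
by rewrite !deriveE// linearB.
Qed.

(** Used to write a derivative in a direction that varies with time as a sum of scalar curves times
    derivatives in fixed directions. *)
Lemma pair_sum_delta (R : realType) (V : normedModType R) n (a : 'rV[R]_n) :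
  (a, 0 : V) = \sum_j a 0 j *: ('e_j, 0).
Proof.
rewrite [X in (X, _)]row_sum_delta.
rewrite (big_morph (fun z : 'rV[R]_n => (z, 0 : V)) (id1 := 0) (op1 := +%R))//.
  by apply: eq_bigr => j _; congr pair; rewrite scaler0.
by move=> x y; congr pair; rewrite addr0.
Qed.

Section AdCurve.
Variables (R : realType) (G : lieGroup R) (c : chart R (ldim G) G).
Hypotheses (cA : atlas c) (c1 : cdom c 1%g).
Variables (gam : R -> G) (u : 'rV[R]_(ldim G)).
Hypotheses (gam0 : gam 0 = 1%g) (gam_cont : {for 0, continuous gam}).
Hypothesis gam_deriv : is_derive (0 : R) 1 (fun t => c (gam t)) u.
Local Notation E := 'rV[R]_(ldim G).
Local Notation e := (c 1%g).
Local Notation m := (chart_mul c).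

Let near_gam : \forall t \near (0 : R), cdom c (gam t).
Proof.
apply: gam_cont; apply: open_nbhs_nbhs; rewrite gam0.
by split => //; exact: cdom_open.
Qed.

Let near_gamV : \forall t \near (0 : R), cdom c (gam t)^-1%g.
Proof.
have ic := continuous_comp gam_cont (@linv_cont R G _).
apply: ic; apply: open_nbhs_nbhs; rewrite /= gam0 invg1.
by split => //; exact: cdom_open.
Qed.

Let Wee := chart_mul_dom_ee c1.

(** Smoothness of inversion provides some velocity [w]. Differentiating the constant
    [m (c (gam t), c (gam t)^-1) = e] gives [u + w = 0]. *)
Lemma is_derive_chart_inv : is_derive (0 : R) 1 (fun t => c (gam t)^-1%g) (- u).
Proof.
have e_inv : ccod c e /\ cdom c (cinv c e)^-1%g.
  by rewrite cinv_e// invg1; split => //; exact: ccod_e.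
have inv_diff := (linv_smooth cA cA 1).1 _ e_inv.
have ig : is_derive (0 : R) 1 (fun t => c (gam t)^-1%g)
    ('D_u (fun v => c (cinv c v)^-1%g) e).
  have := is_derive_curve gam_deriv; rewrite gam0 => /(_ _ _ inv_diff).
  apply: near_eq_is_derive; apply: filterS near_gam => t /= ct.
  by rewrite chart_mapK.
set w := 'D_u _ e in ig; suff -> : - u = w by [].
have gi := is_derive_pair_curve gam_deriv ig.
have md : differentiable m (c (gam 0), c (gam 0)^-1%g).
  by rewrite gam0 invg1; exact: chart_mul_diff.
have [_] := is_derive_curve gi md.
rewrite gam0 invg1 derive_chart_mul_ee//.
have -> : 'D_1 (m \o (fun t => (c (gam t), c (gam t)^-1%g))) (0 : R) = 0.
  apply: etrans (derive_cst e (0 : R) 1); apply: near_eq_derive.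
  apply: filterS2 near_gam near_gamV => t ct ct'.
  by rewrite /chart_mul /= !chart_mapK// mulgV.
by move/esym/eqP; rewrite addr_eq0 => /eqP ->; rewrite opprK.
Qed.

Lemma is_derive_Ad v :
  is_derive (0 : R) 1 (fun t => Ad c (gam t) v) (tangent_lie c u v).
Proof.
(* The direction [w t] moves with [t]; expanding it in the basis gives coordinates [w t 0 j] and
   derivatives [f j t] in fixed directions, to which the Leibniz rule applies. *)
pose w t := 'D_(0, v) m (c (gam t), e).
pose f j t := 'D_('e_j, 0) m (c (gam t), c (gam t)^-1%g).
have near_Ad : \forall t \near (0 : R),
    \sum_j w t 0 j *: f j t = Ad c (gam t) v.
  apply: filterS2 near_gam near_gamV => t ct ct'; rewrite AdE//.
  rewrite pair_sum_delta derive_sum_dir//.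
  apply: chart_mul_diff => //; split => /=; do ?exact: chart_map_cod.
  by rewrite !chart_mapK// mulgV.
apply: near_eq_is_derive near_Ad _.
have w0 : w 0 = v by rewrite /w gam0 derive_chart_mul1l//; exact: ccod_e.
have wd : is_derive (0 : R) 1 w ('D_(u, 0) ('D_(0, v) m) (e, e)).
  have md2 := chart_mul_diff2 cA (0, v) Wee.
  have md : differentiable (fun x => 'D_(0, v) m (x, e)) (c (gam 0)).
    by rewrite gam0; exact: differentiable_pairl md2.
  have [_ <-] := is_derive_pairl u md2.
  by have := is_derive_curve gam_deriv md; rewrite gam0.
have fd j : is_derive (0 : R) 1 (f j) ('D_(u, - u) ('D_('e_j, 0) m) (e, e)).
  have gi := is_derive_pair_curve gam_deriv is_derive_chart_inv.
  have := is_derive_curve gi; rewrite gam0 invg1; apply.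
  exact: chart_mul_diff2.
have f0 j : f j 0 = 'e_j.
  by rewrite /f gam0 invg1 derive_chart_mul1r//; exact: ccod_e.
have wd0 j := is_derive_entry 0 j wd.
have sd := is_derive_sum (fun j => is_derive_scale (wd0 j) (fd j)).
have sE : \sum_j (fun t => w t 0 j *: f j t) =
    (fun t => \sum_j w t 0 j *: f j t).
  by apply/funext => t; rewrite fct_sumE.
apply: is_derive_eq (eq_ind _ (fun g => is_derive (0 : R) 1 g _) sd _ sE) _.
under eq_bigr do rewrite f0 w0.
rewrite big_split /= -row_sum_delta tangent_lieE//; congr (_ + _).
have near_md : \forall p \near (e, e), differentiable m p.
  by apply: filterS (chart_mul_dom_nbhs Wee) => p; exact: chart_mul_diff.
(* Exchanging the derivatives puts the basis direction outermost, where the sum weighted by the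
   coordinates of [v] recombines into the single direction [(v, 0)]. *)
have commute j : 'D_(u, - u) ('D_('e_j, 0) m) (e, e) =
    'D_('e_j, 0) ('D_(u, - u) m) (e, e).
  by apply: derive_commute near_md _ _; exact: chart_mul_diff2.
under eq_bigr do rewrite commute.
rewrite -derive_sum_dir; last exact: chart_mul_diff2.
rewrite -pair_sum_delta.
have D0 : 'D_(v, 0) ('D_(u, 0) m) (e, e) = 0.
  have [_ D0] := is_derive_pairl v (chart_mul_diff2 cA (u, 0) Wee).
  apply: etrans (esym D0) (etrans _ (derive_cst u e v)); apply: near_eq_derive.
  by apply: filterS (ccod_nbhs (ccod_e c1)) => x; exact: derive_chart_mul1r.
apply: etrans (etrans (congr1 (fun z => z - _) D0) (sub0r _)).
have dirE : (u, - u) = (u, 0) - (0, u) :> E * E.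
  by congr pair; rewrite ?subr0 ?sub0r.
rewrite dirE; apply: derive_dirB; try exact: chart_mul_diff2.
exact: near_md.
Qed.

End AdCurve.

Lemma Ad1 (R : realType) (G : lieGroup R) (c : chart R (ldim G) G) v :
  atlas c -> cdom c 1%g -> Ad c 1%g v = v.
Proof.
move=> cA c1; rewrite AdE ?invg1//.
by rewrite derive_chart_mul1r ?derive_chart_mul1l//; exact: ccod_e.
Qed.

(** * Deformations *)

Section LieTheory.
Variables (K : fieldType) (g : lieAlgType K).
Implicit Types x y z : g.

Lemma lieDl x y z : lie (x + y) z = lie x z + lie y z.
Proof. by rewrite -[x]scale1r lie_linearl !scale1r. Qed.

Lemma lieDr x y z : lie z (x + y) = lie z x + lie z y.
Proof. by rewrite -[x]scale1r lie_linearr !scale1r. Qed.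

Lemma lier0 x : lie x 0 = 0.
Proof. by apply: (@addrI _ (lie x 0)); rewrite -lieDr !addr0. Qed.

Lemma lierN x y : lie x (- y) = - lie x y.
Proof. by apply/eqP; rewrite -addr_eq0 -lieDr addNr lier0. Qed.

Lemma lieC x y : lie x y = - lie y x.
Proof.
apply/eqP; rewrite -addr_eq0; have := lie_xx (x + y).
by rewrite lieDl !lieDr !lie_xx add0r addr0 => ->.
Qed.

End LieTheory.

Lemma lie_group_morph1 (R : realType) (G H : lieGroup R) (F : G -> H) :
  lie_group_morph F -> F 1%g = 1%g.
Proof. by case=> FM _ _; apply: (@mulgI _ (F 1%g)); rewrite -FM !mulg1. Qed.

(** * Velocities of curves and Taylor coefficients of the adjoint action *)

Section Curves.
Variables (R : realType) (K : fieldType) (iota : {rmorphism R -> K}).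

Lemma smooth_curve_derive (G : lieGroup R) (c : chart R (ldim G) G)
    (gam : R -> G) :
  atlas c -> cdom c (gam 0) -> smooth_curve_at0 gam ->
  {for 0, continuous gam} /\
  is_derive (0 : R) 1 (fun t => c (gam t)) ('D_1 (fun t => c (gam t)) (0 : R)).
Proof.
move=> cA c0 [r r0 [gc gs]]; split; first by apply: gc; rewrite normr0.
have [sd _] := gs c cA 1%N; apply: derivableP.
by apply: diff_derivable; apply: sd; split => //; rewrite normr0.
Qed.

Lemma Ad_taylor0 (G : lieGroup R) (g : lieAlgType K) (I : integration iota G g)
    (gam : R -> G) (x : g) :
  gam 0 = 1%g -> Ad_taylor I gam 0 x = x.
Proof.
move=> gam0; rewrite /Ad_taylor derive1n0 gam0 Ad1; last exact: ichart1.
  by rewrite fact0 invr1 scale1r iso_invK.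
exact: ichart_atlas.
Qed.

(** The derivative of [Ad] along the curve is [tangent_lie], which [iso] carries to the bracket of
    [g]. *)
Lemma Ad_taylor1 (G : lieGroup R) (g : lieAlgType K) (I : integration iota G g)
    (gam : R -> G) (u : 'rV[R]_(ldim G)) (x : g) :
  gam 0 = 1%g -> {for 0, continuous gam} ->
  is_derive (0 : R) 1 (fun t => ichart I (gam t)) u ->
  Ad_taylor I gam 1 x = lie (iso I u) x.
Proof.
move=> gam0 gc gd; rewrite /Ad_taylor derive1n1 (_ : 1`!%:R = 1)//.
rewrite invr1 scale1r derive1E.
have [_ ->] :=
  is_derive_Ad (ichart_atlas I) (ichart1 I) gam0 gc gd (iso_inv I x).
by rewrite iso_lie iso_invK.
Qed.

(** Chain rule in the charts: [w] is the image of [u] under the differential of [F] at 1, which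
    [integrates_morph] identifies with [f]. *)
Lemma is_derive_morph_curve (G H : lieGroup R) (g h : lieAlgType K)
    (IG : integration iota G g) (IH : integration iota H h) (F : G -> H)
    (f : g -> h) (gam : R -> G) (u : 'rV[R]_(ldim G)) :
  integrates_morph IG IH F f -> gam 0 = 1%g -> {for 0, continuous gam} ->
  is_derive (0 : R) 1 (fun t => ichart IG (gam t)) u ->
  exists2 w, is_derive (0 : R) 1 (fun t => ichart IH (F (gam t))) w &
    iso IH w = f (iso IG u).
Proof.
move=> [FG dF] gam0 gc gd; have F1 := lie_group_morph1 FG.
have [_ _ /(_ _ _ (ichart_atlas IG) (ichart_atlas IH) 1%N)[Fd _]] := FG.
have {}Fd := Fd (ichart IG 1%g).
have c1 := ichart1 IG.
have {}Fd : differentiable (fun y => ichart IH (F (cinv (ichart IG) y)))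
    (ichart IG 1%g).
  apply: Fd; split; first exact: ccod_e.
  by rewrite cinv_e// F1; exact: ichart1.
exists ('D_u (fun y => ichart IH (F (cinv (ichart IG) y))) (ichart IG 1%g)).
  have := is_derive_curve gd; rewrite gam0 => /(_ _ _ Fd).
  apply: near_eq_is_derive.
  have near_c : \forall t \near (0 : R), cdom (ichart IG) (gam t).
    apply: gc; apply: open_nbhs_nbhs; rewrite gam0; split => //.
    exact: cdom_open.
  by apply: filterS near_c => t /= ct; rewrite chart_mapK.
by rewrite deriveE// dF.
Qed.

End Curves.

(** * The complex in low degrees and infinitesimals of deformations *)

Section Complex.
Variables (K : fieldType) (phi phi' : morphismLie K).
Variable ab : morphismLie_hom phi phi'.

Lemma CE_deg0 (g : lieAlgType K) (V : lmodType K) (rho : g -> V -> V)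
    (f : ('I_0 -> g) -> V) x :
  CE rho f x = rho (x ord0) (f (omit ord0 x)).
Proof.
rewrite /CE !big_ord1 expr0 scale1r big_pred0 ?addr0// => j.
by rewrite (ord1 j).
Qed.

(** Only the pair of indices [0 < 1] contributes to the double sum, with sign -1. *)
Lemma CE_deg1 (g : lieAlgType K) (V : lmodType K) (rho : g -> V -> V)
    (f : g -> V) x :
  CE rho (fun y : 'I_1 -> g => f (y ord0)) x =
  rho (x ord0) (f (x ord_max)) - rho (x ord_max) (f (x ord0))
    - f (lie (x ord0) (x ord_max)).
Proof.
rewrite /CE !big_ord_recl !big_ord0 /= !big_mkcond /=.
rewrite !big_ord_recl !big_ord0 /= [X in _ + (X + 0)]big_pred0; last first.
  by move=> j; rewrite ltnNge -ltnS ltn_ord.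
have -> : lift ord0 ord0 = ord_max :> 'I_2 by apply: val_inj.
have -> : omit ord0 x ord0 = x ord_max by congr x; apply: val_inj.
have -> : omit ord_max x ord0 = x ord0 by congr x; apply: val_inj.
by rewrite /contract_args/= expr0 expr1 scale1r !scaleN1r !(addr0, add0r).
Qed.

Lemma dmLA0E (a : mdom phi') : dmLA ab (n := 0) a =
  (fun x => lie (hdom ab (x ord0)) a,
   fun x => lie (hcod ab (x ord0)) (phi' a), fun=> 0) :> precochain phi phi' 1.
Proof. by congr (_, _, _); apply/funext => x; exact: CE_deg0. Qed.

Lemma dmLA0B (a b : mdom phi') :
  dmLA ab (n := 0) (a - b) = dmLA ab (n := 0) a - dmLA ab (n := 0) b.
Proof.
rewrite !dmLA0E; congr (_, _, _); apply/funext => x.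
- by apply: etrans (lieDr _ _ _) _; rewrite lierN.
- by rewrite linearB; apply: etrans (lieDr _ _ _) _; rewrite lierN.
- by apply/esym; exact: subrr.
Qed.

Lemma alternating_linear (g V : lmodType K) (f : {linear g -> V}) :
  Defs.alternating (fun x : 'I_1 -> g => f (x ord0)).
Proof.
split=> [x i a u v /=|x i j]; last by rewrite (ord1 i) (ord1 j).
by rewrite (ord1 i) linearP.
Qed.

Lemma infinitesimal_cocycle (D : deformation ab) : ZmLA ab (infinitesimal D).
Proof.
split.
  split; [exact: alternating_linear|exact: alternating_linear|].
  by split=> x [].
(* In the first two components [c] is the value of the degree-1 coefficient on a bracket; the
   degree-1 part of multiplicativity gives [c = a - b], after antisymmetry in one term. *)
have cocycle (k : lieAlgType K) (a b c : k) : c = a - b -> a - b - c = 0.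
  by move=> ->; rewrite subrr.
congr (_, _, _); apply/funext => x.
- apply: etrans (CE_deg1 _ _ _) _; apply: cocycle.
  rewrite (dalpha_lie D) /ps_mul !big_ord_recl big_ord0 /= addr0.
  by rewrite !dalpha0 [X in _ + X]lieC.
- apply: etrans (CE_deg1 _ _ _) _; apply: cocycle.
  rewrite (dbeta_lie D) /ps_mul !big_ord_recl big_ord0 /= addr0.
  by rewrite !dbeta0 [X in _ + X]lieC.
(* The square condition in degree 1 cancels the first two terms; [CE3] of the zero cochain
   remains. *)
- rewrite /= dsquare subrr sub0r; apply/eqP; rewrite oppr_eq0; apply/eqP.
  by apply: etrans (CE_deg0 _ _ _) _; exact: lier0.
Qed.

(** Shifting a primitive [y] by [z] in either direction passes from one coset to the other. *)
Lemma mLA_class_eq (c c' : precochain phi phi' 1) (z : mdom phi') :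
  c' - c = dmLA ab (n := 0) z -> mLA_class ab c = mLA_class ab c'.
Proof.
move=> cc'; apply/seteqP; split=> d [Zd [y _ yE]]; split=> //.
  exists (y - z) => //; apply: etrans (dmLA0B _ _) _.
  by rewrite yE -cc' opprB addrA subrK.
(* The sum [y + z] is written as a difference so that [dmLA0B] applies; compatibility with opposites
   follows from it through [0 = z - z]. *)
exists (y - (- z)) => //; apply: etrans (dmLA0B _ _) _.
have -> : dmLA ab (n := 0) (- z) = - dmLA ab (n := 0) z.
  rewrite -[- z]sub0r dmLA0B -[in X in X - _ = _](subrr z).
  by rewrite dmLA0B subrr sub0r.
by rewrite yE -cc' opprK addrA subrK.
Qed.

End Complex.

Lemma equivalent_infinitesimals (K : fieldType) (phi phi' : morphismLie K)
    (ab : morphismLie_hom phi phi') (R : realType) (iota : {rmorphism R -> K})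
    (G H : lieGroup R) (IG : integration iota G (mdom phi'))
    (IH : integration iota H (mcod phi')) (Phi : G -> H)
    (D D' : deformation ab) :
  integrates_morph IG IH Phi phi' -> equivalent_deformations IG IH Phi D D' ->
  exists z : mdom phi', infinitesimal D' - infinitesimal D = dmLA ab (n := 0) z.
Proof.
move=> PhiI [gam [gs gam0 aE bE]].
have [|gc gd] := smooth_curve_derive (ichart_atlas IG) _ gs.
  by rewrite gam0; exact: ichart1.
set u := 'D_1 (fun t : R => ichart IG (gam t)) 0 in gd.
have [w wd wE] := is_derive_morph_curve PhiI gam0 gc gd.
have [PhiM _] := PhiI; have Phi1 := lie_group_morph1 PhiM.
have Pgam0 : (Phi \o gam) 0 = 1%g by rewrite /= gam0.
have Pgc : {for 0, continuous (Phi \o gam)}.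
  by apply: continuous_comp gc _; case: PhiM => _ + _; apply.
(* The coboundary of [z] is [[alpha x, z]] while the infinitesimals differ by [[xi, alpha x]] with
   [xi = iso IG u]; antisymmetry accounts for the sign. *)
exists (- iso IG u); rewrite dmLA0E; congr (_, _, _); apply/funext => x.
- rewrite lierN -lieC; apply/eqP; rewrite subr_eq; apply/eqP.
  apply: etrans (aE _ _) _; rewrite /ps_mul !big_ord_recl big_ord0 /= addr0.
  by rewrite Ad_taylor0// (Ad_taylor1 _ gam0 gc gd) dalpha0 addrC.
- rewrite (linearN phi') lierN -lieC; apply/eqP; rewrite subr_eq; apply/eqP.
  apply: etrans (bE _ _) _; rewrite /ps_mul !big_ord_recl big_ord0 /= addr0.
  by rewrite Ad_taylor0// (Ad_taylor1 _ Pgam0 Pgc wd) dbeta0 wE addrC.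
- exact: subrr.
Qed.

Theorem proposition4p3 (K : fieldType) (charK : [pchar K] =i pred0)
    (phi phi' : morphismLie K) (ab : morphismLie_hom phi phi')
    (D : deformation ab) :
  ZmLA ab (infinitesimal D) /\
  (forall (R : realType) (iota : {rmorphism R -> K}) (G' H' : lieGroup R)
     (IG : integration iota G' (mdom phi'))
     (IH : integration iota H' (mcod phi'))
     (Phi : G' -> H'),
     simply_connected R G' -> simply_connected R H' ->
     integrates_morph IG IH Phi phi' ->
     forall D' : deformation ab,
       equivalent_deformations IG IH Phi D D' ->
       mLA_class ab (infinitesimal D) = mLA_class ab (infinitesimal D')).
Proof.
split; first exact: infinitesimal_cocycle.
move=> R iota G' H' IG IH Phi _ _ PhiI D' DD'.
by have [z /mLA_class_eq] := equivalent_infinitesimals PhiI DD'.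
Qed.
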